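(* For every integer $k \ge 3$, $\operatorname{hc}(3,k) \ge \mathrm{sf}(k-1)$.
   Context: Graphs are finite and without loops; parallel edges are allowed. For such a graph $G$, the cycle matroid $M_G$ has ground set $E(G)$, and its bases are the edge sets of the spanning trees of $G$. For a matroid $M$, its basis graph $\operatorname{BG}(M)$ has the bases of $M$ as vertices, two bases $B, B'$ being adjacent if and only if $|B\triangle B'|=2$. For an edge $\epsilon$ of $\operatorname{BG}(M)$, let $\operatorname{HC}_\epsilon(M)$ be the number of distinct Hamiltonian cycles of $\operatorname{BG}(M)$ containing $\epsilon$. Define $\operatorname{HC}^*(M)=\min\{\operatorname{HC}_\epsilon(M) : \epsilon \in E(\operatorname{BG}(M))\}$. Define $\operatorname{hc}(n,k)=\min\{\operatorname{HC}^*(M_G) : G \text{ a $k$-edge-connected graph of order } n\}$. The superfactorial of a nonnegative integer $x$ is $\mathrm{sf}(x)=x!\,(x-1)!\cdots 1!\,0!$. *)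

(* Defs.v *)
From HB Require Import structures.
From mathcomp Require Import all_boot.
From mathcomp Require Import boolp.

Set Implicit Arguments.
Unset Strict Implicit.
Unset Printing Implicit Defensive.

Local Open Scope nat_scope.

(* Loopless finite multigraphs: distinct edges may have the same ends. *)
Record mgraph := MGraph {
  vertex : finType;
  edge : finType;
  ends : edge -> {set vertex};
  card_ends : forall e, #|ends e| = 2
}.

Definition order (G : mgraph) := #|vertex G|.

Definition adjacent (G : mgraph) (F : {set edge G}) : rel (vertex G) :=
  fun x y => [exists e in F, ends e == [set x; y]].

(* The spanning subgraph with edge set F is connected. *)
Definition connected_by (G : mgraph) (F : {set edge G}) : bool :=
  [forall x, forall y, connect (adjacent F) x y].

Definition connected (G : mgraph) : bool := connected_by [set: edge G].

Definition edge_connected (k : nat) (G : mgraph) : Prop :=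
  1 < order G /\
  forall F : {set edge G}, #|F| < k -> connected_by (~: F).

(* The distinct edges es join the cyclically consecutive terms of the list vs
   of distinct vertices. Lists of length 1 are ruled out by card_ends; lists of
   length 2 give the cycles formed by two parallel edges. *)
Definition cycle_through (G : mgraph) (vs : seq (vertex G))
    (C : {set edge G}) : Prop :=
  exists es : seq (edge G),
    [/\ vs != [::], uniq vs, uniq es,
        [seq ends e | e <- es] = [seq [set x; next vs x] | x <- vs]
      & C =i es].

Definition is_cycle (G : mgraph) (C : {set edge G}) : Prop :=
  exists vs, cycle_through vs C.

Definition is_hamiltonian_cycle (G : mgraph) (C : {set edge G}) : Prop :=
  exists vs, cycle_through vs C /\ forall x, x \in vs.

Definition acyclic (G : mgraph) (F : {set edge G}) : Prop :=
  forall C : {set edge G}, C \subset F -> ~ is_cycle C.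

Definition is_spanning_tree (G : mgraph) (T : {set edge G}) : Prop :=
  connected_by T /\ acyclic T.

Record matroid (E : finType) := Matroid {
  bases : {set {set E}};
  bases_neq0 : bases != set0;
  bases_exchange : forall B1 B2 x, B1 \in bases -> B2 \in bases ->
    x \in B1 :\: B2 ->
    exists2 y, y \in B2 :\: B1 & y |: (B1 :\ x) \in bases
}.

Section CycleMatroid.
Variable G : mgraph.
Implicit Types (F C T : {set edge G}) (e f : edge G) (x y z : vertex G).

Lemma adjacentP F x y :
  reflect (exists2 e, e \in F & ends e = [set x; y]) (adjacent F x y).
Proof. by apply: (iffP exists_inP) => -[e eF /eqP]; exists e => //; apply/eqP. Qed.

Lemma connect_adjacent_sym F : connect_sym (adjacent F).
Proof. by apply: sym_connect_sym => x y; rewrite /adjacent setUC. Qed.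

Lemma connect_ends F e x y :
  e \in F -> ends e = [set x; y] -> connect (adjacent F) x y.
Proof. by move=> eF ee; apply: connect1; apply/adjacentP; exists e. Qed.

Lemma connected_byP F :
  reflect (forall x y, connect (adjacent F) x y) (connected_by F).
Proof.
by apply: (iffP forallP) => [h x|h x]; [move: (h x) => /forallP | apply/forallP].
Qed.

Lemma sub_adjacent F C : F \subset C ->
  subrel (connect (adjacent F)) (connect (adjacent C)).
Proof.
move=> /subsetP sFC; apply: connect_sub => x y /adjacentP[e eF ee].
by apply: connect_ends ee; rewrite sFC.
Qed.

Lemma endsP e : exists x y, ends e = [set x; y].
Proof. by have /eqP/cards2P[x [y [_ ->]]] := card_ends e; exists x, y. Qed.

Lemma connect_swap F e x y u v : ends e = [set x; y] -> ends e = [set u; v] ->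
  connect (adjacent F) x y -> connect (adjacent F) u v.
Proof.
move=> exy euv cxy.
have : u \in ends e by rewrite euv !inE eqxx.
have : v \in ends e by rewrite euv !inE eqxx orbT.
have : u != v by have := card_ends e; rewrite euv cards2; case: eqP.
rewrite exy !inE => uv /orP[]/eqP vE /orP[]/eqP uE; move: uv; subst u v;
  by rewrite ?eqxx // connect_adjacent_sym.
Qed.

Local Notation set2 := (fun x y => [set x; y]).

Lemma cycle_pairs x (p : seq (vertex G)) : uniq (x :: p) ->
  [seq [set z; next (x :: p) z] | z <- x :: p] = pairmap set2 x (rcons p x).
Proof.
move=> up; have := cycle_next up; move: (next (x :: p)) => f; rewrite [fcycle _ _]/=.
rewrite -(belast_rcons x p x) {up}; move: (rcons p x) => s; elim: s x => //= y s IHs x.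
by case/andP=> /eqP -> /IHs ->.
Qed.

Lemma pairs_connect (es : seq (edge G)) x (s : seq (vertex G)) :
  [seq ends e | e <- es] = pairmap set2 x s ->
  connect (adjacent [set:: es]) x (last x s).
Proof.
elim: s x es => [|y s IHs] x [|e es] //= [ee /IHs cs].
apply: connect_trans (connect_ends (e := e) _ ee) _; first by rewrite !inE eqxx.
by apply: sub_adjacent cs; apply/subsetP=> f; rewrite !inE => ->; rewrite orbT.
Qed.

Lemma path_edges F x (p : seq (vertex G)) : path (adjacent F) x p ->
  exists2 es, {subset es <= F} & [seq ends e | e <- es] = pairmap set2 x p.
Proof.
elim: p x => [|y p IHp] x /=; first by exists [::].
case/andP=> /adjacentP[e eF ee] /IHp[es sF ees]; exists (e :: es) => /=.
  by move=> f; rewrite inE => /predU1P[->|/sF].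
by rewrite ee ees.
Qed.

Lemma uniq_pairs x (p : seq (vertex G)) :
  uniq (x :: p) -> uniq (pairmap set2 x p).
Proof.
elim: p x => //= y p IHp x /andP[xNp up]; rewrite IHp // andbT.
have sub a s A z : A \in pairmap set2 a s -> z \in A -> z \in a :: s.
  elim: s a => //= b s IHs a; rewrite inE => /predU1P[->|/IHs h].
    by rewrite !inE orbA => ->.
  by move=> /h zs; rewrite in_cons zs orbT.
by apply: contra xNp => /sub; apply; rewrite !inE eqxx.
Qed.

Lemma cycle_connect C e x y : is_cycle C -> e \in C -> ends e = [set x; y] ->
  connect (adjacent (C :\ e)) x y.
Proof.
case=> vs [es [_ uvs ues E CE]]; rewrite CE => eC exy.
have [i es' rE] := rot_to eC.
have {}E : [seq ends e | e <- rot i es]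
    = [seq [set z; next (rot i vs) z] | z <- rot i vs].
  by rewrite map_rot E -map_rot; apply: eq_map => z; rewrite next_rot.
rewrite rE in E; move: ues; rewrite -(rot_uniq i) rE /= => /andP[eNes _].
move: E uvs; rewrite -(rot_uniq i); case: (rot i vs) => // u p E up.
move: E; rewrite cycle_pairs //=; case Ep: (rcons p u) => [|v s] //=.
case=> euv /pairs_connect; have -> : last v s = u.
  by have := last_rcons u p u; rewrite Ep.
rewrite connect_adjacent_sym => cuv; apply: connect_swap euv exy _.
apply: sub_adjacent cuv; apply/subsetP=> f; rewrite !inE => fes.
rewrite CE -(mem_rot i) rE in_cons fes orbT andbT.
by apply: contraNneq eNes => <-.
Qed.

Lemma connect_cycle F e x y : e \notin F -> ends e = [set x; y] ->
  connect (adjacent F) x y -> exists2 C, is_cycle C & C \subset e |: F.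
Proof.
move=> eNF ee /connectP[p0 pp0 yE]; rewrite {y}yE in ee.
case/shortenP: pp0 ee => p pp up _ ee.
have [es sF Ees] := path_edges pp; exists [set:: rcons es e]; last first.
  apply/subsetP=> f; rewrite !inE mem_rcons in_cons => /orP[->//|/sF ->].
  by rewrite orbT.
exists (x :: p), (rcons es e); split=> // [||f]; last by rewrite inE.
  rewrite rcons_uniq (contra (@sF e)) //.
  by apply: (@map_uniq _ _ (@ends G)); rewrite Ees uniq_pairs.
by rewrite cycle_pairs // map_rcons -!cats1 pairmap_cat Ees ee /= setUC.
Qed.

Lemma connected_byD1 F e x y : connected_by F -> ends e = [set x; y] ->
  connect (adjacent (F :\ e)) x y -> connected_by (F :\ e).
Proof.
move=> /connected_byP cF ee cxy; apply/connected_byP=> u v.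
apply: connect_sub (cF u v) => {}u {}v /adjacentP[f fF fuv].
have [fe|fe] := eqVneq f e; first by rewrite fe in fuv; apply: (connect_swap ee fuv cxy).
by apply: connect_ends fuv; rewrite !inE fe.
Qed.

Definition spanning_trees : {set {set edge G}} :=
  [set T | `[< is_spanning_tree T >]].

Lemma spanning_treesP T : reflect (is_spanning_tree T) (T \in spanning_trees).
Proof. by rewrite inE; apply: asboolP. Qed.

Lemma spanning_trees_neq0 : connected G -> spanning_trees != set0.
Proof.
move=> cG; have [T /minsetP[cT minT] _] := minset_exists cG.
apply/set0Pn; exists T; apply/spanning_treesP; split=> // C sCT cC.
have [es Ces] : exists e, e \in C.
  case: (cC) => -[|x p] [[|e es] [// _ _ _ //= _ CE]].
  by exists e; rewrite CE inE eqxx.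
have [x [y ee]] := endsP es; have cxy := cycle_connect cC Ces ee.
have := minT (T :\ es) (connected_byD1 cT ee (sub_adjacent (setSD _ sCT) cxy)).
by move/(_ (subD1set _ _))/setP/(_ es); rewrite !inE eqxx (subsetP sCT).
Qed.

Lemma spanning_trees_exchange T1 T2 e :
  T1 \in spanning_trees -> T2 \in spanning_trees -> e \in T1 :\: T2 ->
  exists2 f, f \in T2 :\: T1 & f |: (T1 :\ e) \in spanning_trees.
Proof.
move=> /spanning_treesP[/connected_byP c1 a1] /spanning_treesP[/connected_byP c2 _].
rewrite inE => /andP[eN2 e1]; have [x [y ee]] := endsP e.
set F := T1 :\ e; have eF : e |: F = T1 by rewrite setD1K.
have Nxy : ~~ connect (adjacent F) x y.
  apply/negP=> /(connect_cycle _ ee)[|C cC]; first by rewrite !inE eqxx.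
  by rewrite eF => /a1.
have cross p a : path (adjacent T2) a p -> connect (adjacent F) x a ->
    ~~ connect (adjacent F) x (last a p) ->
    exists f u v, [/\ f \in T2, ends f = [set u; v],
      connect (adjacent F) x u & ~~ connect (adjacent F) x v].
  elim: p a => [|b p IHp] a /=; first by move=> _ ->.
  case/andP=> /adjacentP[f f2 fab] /IHp{}IHp cxa.
  by have [/IHp|Ncxb _] := boolP (connect (adjacent F) x b); last by exists f, a, b.
have [f [u [v [f2 fuv cxu Ncxv]]]] : exists f u v, [/\ f \in T2,
    ends f = [set u; v], connect (adjacent F) x u
    & ~~ connect (adjacent F) x v].
  case/connectP: (c2 x y) => p pp yE; apply: (cross p x) => //.
  by rewrite -yE.
have Nuv : ~~ connect (adjacent F) u v.
  by apply: contra Ncxv; apply: connect_trans.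
have fNF : f \notin F.
  by apply: contra Nuv => fF; apply: connect_ends fuv.
have fN1 : f \notin T1.
  rewrite -eF in_setU1 negb_or fNF andbT.
  by apply: contraNneq eN2 => <-.
exists f; first by rewrite inE fN1.
have split_xy z : connect (adjacent F) x z || connect (adjacent F) y z.
  have step p a : path (adjacent T1) a p ->
      connect (adjacent F) x a || connect (adjacent F) y a ->
      connect (adjacent F) x (last a p) || connect (adjacent F) y (last a p).
    elim: p a => //= b p IHp a /andP[/adjacentP[g g1 gab] pp] ca.
    apply: (IHp b pp); have [ge|gNe] := eqVneq g e.
      have : b \in ends g by rewrite gab !inE eqxx orbT.
      by rewrite ge ee !inE => /orP[]/eqP ->; rewrite connect0 ?orbT.
    have cab : connect (adjacent F) a b.
      by apply: connect_ends gab; rewrite !inE gNe.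
    by case/orP: ca => /connect_trans/(_ cab) ->; rewrite ?orbT.
  by case/connectP: (c1 x z) => p pp ->; apply: step; rewrite ?connect0.
have cyv : connect (adjacent F) y v.
  by have := split_xy v; rewrite (negbTE Ncxv).
have sF : F \subset f |: F by apply: subsetUr.
apply/spanning_treesP; split.
  apply/connected_byP=> a b.
  apply: connect_sub (c1 a b) => {}a {}b /adjacentP[g g1 gab].
  have [ge|gNe] := eqVneq g e; last first.
    by apply: connect_ends gab; rewrite !inE gNe g1 orbT.
  rewrite ge in gab; apply: connect_swap ee gab _.
  apply: connect_trans (sub_adjacent sF cxu) _.
  apply: connect_trans (connect_ends _ fuv) _; first by rewrite !inE eqxx.
  by rewrite connect_adjacent_sym (sub_adjacent sF cyv).
move=> C sC cC; have [fC|fNC] := boolP (f \in C).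
  case/negP: Nuv; apply: sub_adjacent (cycle_connect cC fC fuv).
  by rewrite subDset.
apply: (a1 C) cC; rewrite -eF; apply/subsetP=> g gC.
have := subsetP sC g gC; rewrite !inE => /orP[/eqP gf|->]; last by rewrite orbT.
by rewrite -gf gC in fNC.
Qed.

Definition cycle_matroid (cG : connected G) : matroid (edge G) :=
  Matroid (spanning_trees_neq0 cG) spanning_trees_exchange.

End CycleMatroid.

Section BasisGraph.
Variables (E : finType) (M : matroid E).

Definition basis : finType := {B : {set E} | B \in bases M}.

Definition exchange_adjacent (B B' : basis) : bool :=
  #|(val B :\: val B') :|: (val B' :\: val B)| == 2.

Definition basis_edge : finType := {e : {set basis} |
  [exists B, exists B', (e == [set B; B']) && exchange_adjacent B B']}.

Lemma card_basis_edge (e : basis_edge) : #|val e| = 2.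
Proof.
have /existsP[B /existsP[B' /andP[/eqP-> adjBB']]] := valP e.
rewrite cards2; case: eqP adjBB' => // ->.
by rewrite /exchange_adjacent setDv setU0 cards0.
Qed.

Definition basis_graph : mgraph := MGraph card_basis_edge.

End BasisGraph.

(* Hamiltonian cycles are counted as edge sets, so up to rotation and reversal
   of the cyclic order on the vertices. *)
Definition HC_edge (E : finType) (M : matroid E)
    (eps : edge (basis_graph M)) : nat :=
  #|[set H : {set edge (basis_graph M)} |
      `[< is_hamiltonian_cycle H >] & eps \in H]|.

(* The least element of P, or 0 when P is empty. *)
Definition min_nat (P : nat -> Prop) : nat :=
  if pselect (exists m, `[< P m >]) is left exP then ex_minn exP else 0.

Definition HC_star (E : finType) (M : matroid E) : nat :=
  min_nat (fun m => exists eps : edge (basis_graph M), m = HC_edge eps).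

(* For k > 0 the connectedness witness cG exists automatically and only serves
   to form the cycle matroid. *)
Definition hc (n k : nat) : nat :=
  min_nat (fun m => exists (G : mgraph) (cG : connected G),
    [/\ order G = n, edge_connected k G & m = HC_star (cycle_matroid cG)]).

Definition superfactorial (x : nat) : nat := \prod_(0 <= i < x.+1) i`!.

(* Main.v *)
Require Import Defs.
From mathcomp Require Import all_boot.
From mathcomp Require Import boolp zify.

(** The spanning trees of a connected graph on three vertices are the pairs of
    non-parallel edges.  A Hamiltonian cycle of the basis graph through the edge
    {t, t'} is a Hamiltonian path from t to t', and such paths are counted by
    deleting an edge e that lies in neither t nor t'.  Every edge has at least
    k edges not parallel to it, say m for e, and this minimum drops by at most 1
    in the graph without e.  The m trees containing e form a clique, so they can
    be spliced in (m - 2)! orders into a step r, r' of a path of the smaller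
    basis graph, provided that r and r' have distinct neighbours in the clique.
    This is so when r and r' differ outside the parallel class of e; as the
    trees avoiding e have at least k traces outside that class, a Hamiltonian
    path has at least k - 1 such steps.  Each path thus extends in at least
    (k - 1)(k - 2)! = (k - 1)! ways, while
    superfactorial (k - 1) = (k - 1)! superfactorial (k - 2). *)

Set Implicit Arguments.
Unset Strict Implicit.
Unset Printing Implicit Defensive.

(** * Counting by duplicate-free lists of witnesses, as the lists to be counted form an infinite
    type *)

Definition many (A : eqType) (N : nat) (P : A -> Prop) :=
  exists s : seq A, [/\ uniq s, N <= size s & {in s, forall x, P x}].

Lemma many_leq (A : eqType) (M N : nat) (P : A -> Prop) :
  M <= N -> many N P -> many M P.
Proof. by move=> leMN [s [us Ns Ps]]; exists s; split=> //; apply: leq_trans Ns. Qed.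

(** The multiplication principle: [g] recovers [x] from each [y] in its fibre, so the lists over
    distinct [x] are disjoint. *)
Lemma many_fiber (A B : eqType) (g : B -> A) M N (Q : A -> Prop) (P : B -> Prop) :
  (forall x, Q x -> many M (fun y => P y /\ g y = x)) ->
  many N Q -> many (N * M) P.
Proof.
move=> fib [s [us Ns Qs]]; apply: (@many_leq _ _ (size s * M)).
  by rewrite leq_mul2r Ns orbT.
suff [r [ur sr Pr]] : many (size s * M) (fun y => P y /\ g y \in s).
  by exists r; split=> // y /Pr[].
elim: s us Qs {N Ns} => [|x s IHs] /=; first by exists [::].
case/andP=> xNs us Qs.
have [|r [ur sr Pr]] := IHs us; first by move=> y ys; apply: Qs; rewrite inE ys orbT.
have [|q [uq sq Pq]] := fib x; first by apply: Qs; rewrite mem_head.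
exists (q ++ r); split.
- rewrite cat_uniq uq ur andbT /=; apply/hasPn=> y /Pr[_ gy].
  by apply: contra xNs => /Pq[_ <-].
- by rewrite size_cat mulSn leq_add.
- move=> y; rewrite mem_cat => /orP[/Pq[Py ->]|/Pr[Py gy]].
    by rewrite mem_head.
  by rewrite inE gy orbT.
Qed.

Lemma many_map (A B : eqType) (f : A -> B) (g : B -> A) N (P : A -> Prop)
    (Q : B -> Prop) :
  (forall x, P x -> Q (f x) /\ g (f x) = x) -> many N P -> many N Q.
Proof.
move=> PQ mP; rewrite -[N]muln1; apply: (many_fiber (g := g)) mP => x /PQ[Qx gx].
by exists [:: f x]; split=> // y; rewrite inE => /eqP->.
Qed.

Lemma leq_card_many (T : finType) (A : {set T}) N (B : eqType) (f : B -> T)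
    (P : B -> Prop) :
  (forall x y, P x -> P y -> f x = f y -> x = y) -> (forall x, P x -> f x \in A) ->
  many N P -> N <= #|A|.
Proof.
move=> inj sub [s [us Ns Ps]]; apply: leq_trans Ns _.
rewrite -(size_map f) cardE; apply: uniq_leq_size.
  by rewrite map_inj_in_uniq // => x y /Ps ? /Ps ?; apply: inj.
by move=> _ /mapP[x /Ps xP ->]; rewrite mem_enum sub.
Qed.

(** [undup] keeps an entry only if it does not occur later, so a kept entry differs from its
    successor; the last entry has none and accounts for the added one. *)
Lemma size_undup_changes (A : eqType) x0 (s : seq A) :
  size (undup s) <=
    (count (fun i => nth x0 s i != nth x0 s i.+1) (iota 0 (size s).-1)).+1.
Proof.
elim: s => [//|x [|y s] IHs] //.
have -> : iota 0 (size [:: x, y & s]).-1 = 0 :: map (addn 1) (iota 0 (size s)).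
  by rewrite -iotaDl.
rewrite [count _ (0 :: _)]/= count_map; set d := count _ _.
have {}IHs : size (undup (y :: s)) <= d.+1 by apply: IHs.
rewrite [undup (x :: _)]/=; case: ifP => [_|/negbT].
  by apply: leq_trans IHs _; rewrite ltnS leq_addl.
by rewrite inE negb_or => /andP[-> _]; rewrite add1n ltnS.
Qed.

(** * Pairs of elements in distinct classes of [c], and Hamiltonian paths of their exchange graph *)

Section RankTwo.
Variables (E : finType) (K : eqType) (c : E -> K).
Implicit Types (S t : {set E}) (e f : E).

(** The relation [exchange_adjacent] on plain sets, so that trees before and after a deletion have
    one type. *)
Definition exch : rel {set E} := fun t t' => #|(t :\: t') :|: (t' :\: t)| == 2.

(** For [c := ends] on three vertices these are the spanning trees with edges in [S]; the classes of
    [c] are the parallel classes. *)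
Definition npairs S : {set {set E}} :=
  [set t : {set E} | (t \subset S) &&
    [exists a, exists b, (t == [set a; b]) && (c a != c b)]].

Definition nonpar S e : {set E} := [set f in S | c f != c e].

Lemma npairsP S t :
  reflect (exists a b, [/\ a \in S, b \in S, c a != c b & t = [set a; b]])
          (t \in npairs S).
Proof.
rewrite inE; apply: (iffP andP) => [[tS]|[a [b [aS bS ab ->]]]].
  case/existsP=> a /existsP[b /andP[/eqP te ab]]; exists a, b; split=> //;
  by apply: (subsetP tS); rewrite te !inE eqxx ?orbT.
split; first by apply/subsetP=> x; rewrite !inE => /orP[]/eqP->.
by apply/existsP; exists a; apply/existsP; exists b; rewrite eqxx.
Qed.

Lemma npairs_at S t e : t \in npairs S -> e \in t ->
  exists2 f, f \in nonpar S e & t = [set e; f].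
Proof.
case/npairsP=> a [b [aS bS ab ->]]; rewrite !inE => /orP[]/eqP->.
  by exists b; rewrite // inE bS eq_sym.
by exists a; rewrite 1?setUC // inE aS.
Qed.

Lemma nonpar_npairs S e f : e \in S -> f \in nonpar S e -> [set e; f] \in npairs S.
Proof.
by move=> eS; rewrite inE => /andP[fS fe]; apply/npairsP; exists e, f; rewrite eq_sym.
Qed.

Lemma npairsD1 S e t : (t \in npairs (S :\ e)) = (t \in npairs S) && (e \notin t).
Proof. by rewrite !inE subsetD1 andbAC. Qed.

Lemma set2_inj e f g : [set e; f] = [set e; g] -> f = g.
Proof.
move=> /setP h; have := h f; have := h g; rewrite !inE !eqxx !orbT.
case/orP=> /eqP gE; last by rewrite gE.
by rewrite gE orbb => /esym/eqP.
Qed.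

Lemma exch_set2 e f g : e != f -> e != g -> f != g -> exch [set e; f] [set e; g].
Proof.
move=> ef eg fg; rewrite /exch.
suff -> : ([set e; f] :\: [set e; g]) :|: ([set e; g] :\: [set e; f]) = [set f; g].
  by rewrite cards2 fg.
apply/setP=> x; rewrite !inE.
have [->|xe] := eqVneq x e; first by rewrite (negbTE ef) (negbTE eg).
have [->|xf] := eqVneq x f; first by rewrite (negbTE fg).
by case: (x == g).
Qed.

Lemma exch_common S t t' e :
  t \in npairs S -> t' \in npairs S -> e \in t -> e \in t' -> t != t' -> exch t t'.
Proof.
move=> tT t'T et et'; have [f fN ->] := npairs_at tT et.
have [g gN ->] := npairs_at t'T et' => fg.
move: fN gN; rewrite !inE => /andP[_ fe] /andP[_ ge].
have ne x : c x != c e -> e != x by apply: contraNneq => ->.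
by apply: exch_set2 (ne _ fe) (ne _ ge) _; apply: contraNneq fg => ->.
Qed.

Lemma exchP S t t' : t \in npairs S -> t' \in npairs S -> exch t t' ->
  exists e f g, [/\ f \in nonpar S e, g \in nonpar S e, f != g,
    t = [set e; f] & t' = [set e; g]].
Proof.
move=> tT t'T tt'.
have card2 u : u \in npairs S -> #|u| = 2.
  by case/npairsP=> a [b [_ _ ab ->]]; rewrite cards2 (contraNneq _ ab) // => ->.
(* Disjoint pairs would have a symmetric difference of size four. *)
have [e] : exists e, e \in t :&: t'.
  apply/set0Pn; apply: contraTneq tt' => I0; rewrite /exch cardsU.
  have -> : t :\: t' = t by apply/setDidPl; rewrite -setI_eq0 I0.
  have -> : t' :\: t = t' by apply/setDidPl; rewrite -setI_eq0 setIC I0.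
  by rewrite I0 cards0 !card2.
rewrite inE => /andP[et et']; have [f fN te] := npairs_at tT et.
have [g gN te'] := npairs_at t'T et'; exists e, f, g; split=> //.
by apply: contraTneq tt' => fg; rewrite te te' fg /exch setDv setU0 cards0.
Qed.

(** The default [set0] is not a tree, so a list joining two trees is nonempty. *)
Definition hpath S t t' (w : seq {set E}) :=
  [/\ head set0 w = t, last set0 w = t', sorted exch w, uniq w & w =i npairs S].

(* Consecutive trees with distinct traces off the class of e have edges f != f'
   outside that class, so a path may detour between them through {e, f} and
   {e, f'}. *)
Definition off_class e t : {set E} := t :\: [set f | c f == c e].

(** The two elements lie in different classes, so at most one lies in that of [e]. *)
Lemma off_class_neq0 S e t : t \in npairs S -> off_class e t != set0.
Proof.
case/npairsP=> a [b [_ _ ab ->]]; apply/set0Pn.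
have [ae|ae] := eqVneq (c a) (c e); last by exists a; rewrite !inE ae eqxx.
by exists b; rewrite !inE eqxx orbT andbT -ae eq_sym.
Qed.

Lemma distinct_elements (A B : {set E}) : A != set0 -> B != set0 -> A != B ->
  exists a b, [/\ a \in A, b \in B & a != b].
Proof.
move=> /set0Pn[a aA] /set0Pn[b bB] AB; have [ab|ab] := eqVneq a b; last by exists a, b.
subst b; move: AB; rewrite eqEsubset negb_and => /orP[]/subsetPn[x xA xB].
  by exists x, a; split=> //; apply: contraNneq xB => ->.
by exists a, x; split=> //; apply: contraNneq xB => <-.
Qed.

Definition star S e : {set {set E}} := [set [set e; f] | f in nonpar S e].

Lemma card_star S e : #|star S e| = #|nonpar S e|.
Proof. by rewrite card_in_imset // => f g _ _; apply: set2_inj. Qed.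

Lemma starE S e t : e \in S -> (t \in star S e) = (t \in npairs S) && (e \in t).
Proof.
move=> eS; apply/imsetP/andP=> [[f fN ->]|[tT et]].
  by rewrite nonpar_npairs // !inE eqxx.
by have [f fN te] := npairs_at tT et; exists f.
Qed.

(* The trees containing e form a clique, hence the free order on those other
   than {e, f} and {e, f'}. *)
Lemma hpath_insert S e t t' (u v : seq {set E}) x y :
  e \in S -> hpath (S :\ e) x y (u ++ t :: t' :: v) ->
  off_class e t != off_class e t' ->
  many (#|nonpar S e| - 2)`! (fun w : seq {set E} => [/\ hpath S x y w,
    [seq r : {set E} <- w | e \notin r] = u ++ t :: t' :: v &
    find (fun r : {set E} => e \in r) w = (size u).+1]).
Proof.
move=> eS [hw lw sw uw ew] tt'.
have wT r : r \in u ++ t :: t' :: v -> (r \in npairs S) && (e \notin r).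
  by rewrite ew npairsD1.
have /andP[tT et] : (t \in npairs S) && (e \notin t).
  by apply: wT; rewrite mem_cat !inE eqxx orbT.
have /andP[t'T et'] : (t' \in npairs S) && (e \notin t').
  by apply: wT; rewrite mem_cat !inE eqxx !orbT.
have [f [f' []]] := distinct_elements (off_class_neq0 e tT) (off_class_neq0 e t'T) tt'.
rewrite !inE => /andP[fP ft] /andP[f'P f't'] ff'.
have inS r g : r \in npairs S -> g \in r -> g \in S.
  by rewrite inE => /andP[/subsetP sr _] /sr.
have fN : f \in nonpar S e by rewrite inE fP (inS t).
have f'N : f' \in nonpar S e by rewrite inE f'P (inS t').
set s := [set e; f]; set s' := [set e; f'].
have sS : s \in star S e by apply: imset_f.
have s'S : s' \in star S e by apply: imset_f.
have ss' : s != s' by apply: contra_neq ff' => /set2_inj.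
have [/andP[sT es] /andP[s'T es']] :
    (s \in npairs S) && (e \in s) /\ (s' \in npairs S) && (e \in s').
  by rewrite -!starE.
pose mid := enum (star S e :\ s :\ s').
(* The detour passes from [t] to [s] by their common edge [f], and from [s'] to [t'] by [f']. *)
pose F q := (u ++ t :: s :: q) ++ s' :: t' :: v.
have Fmid q : q \in permutations mid -> q =i star S e :\ s :\ s'.
  by rewrite mem_permutations => /perm_mem qm r; rewrite qm mem_enum.
have uF q : q \in permutations mid -> uniq q.
  by rewrite mem_permutations => /perm_uniq ->; apply: enum_uniq.
have qe q : q \in permutations mid -> {in s :: rcons q s', forall r, r \in star S e}.
  move=> /Fmid qm r; rewrite inE mem_rcons inE qm !inE.
  by case/or3P=> [/eqP->|/eqP->|/and3P[]].
exists (map F (permutations mid)); split.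
- rewrite map_inj_in_uniq ?permutations_uniq // => q q' qm q'm.
  move/eqP; rewrite /F eqseq_cat.
    by rewrite eqseq_cat // eqxx eqseq_cons eqseq_cons !eqxx /= => /andP[/eqP].
  by move: qm q'm; rewrite !size_cat /= !mem_permutations => /perm_size -> /perm_size ->.
- rewrite size_map size_permutations ?enum_uniq // leq_eqVlt; apply/orP; left.
  apply/eqP; congr _`!; rewrite -cardE -card_star.
  by rewrite (cardsD1 s) sS (cardsD1 s' (_ :\ s)) !inE eq_sym ss' s'S !add1n !subSS subn0.
move=> _ /mapP[q qm ->].
have Fe : F q = u ++ t :: (s :: rcons q s') ++ t' :: v.
  by rewrite /F -catA /= cat_rcons.
have qs r : r \in s :: rcons q s' -> (r \in npairs S) && (e \in r).
  by move=> rq; rewrite -starE //; apply: qe rq.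
have uq : uniq (s :: rcons q s').
  by rewrite /= rcons_uniq uF // mem_rcons inE negb_or ss' !Fmid // !inE !eqxx andbF.
(* Trees through [e] are pairwise adjacent, so any order of them is a path. *)
have cq : sorted exch (s :: rcons q s').
  apply: pairwise_sorted; have := uq; rewrite uniq_pairwise => pq.
  apply: (@sub_in_pairwise _ (mem (s :: rcons q s'))) pq; last by apply/allP.
  by move=> r r' /qs/andP[rT er] /qs/andP[r'T er']; apply: exch_common rT r'T er er'.
(* Moving the detour to the front reduces uniqueness and coverage to those of the star and of the
   old path. *)
have pF : perm_eq (u ++ t :: (s :: rcons q s') ++ t' :: v)
    ((s :: rcons q s') ++ u ++ t :: t' :: v).
  by apply/permPl; have := perm_catCA (u ++ [:: t]) (s :: rcons q s') (t' :: v); rewrite -!catA.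
split.
- rewrite Fe; split.
  + by rewrite -hw; case: (u).
  + by rewrite -lw !last_cat /= last_cat.
  + move: sw; rewrite !sorted_cat_cons => /andP[-> /andP[_ pv]].
    rewrite andTb cat_path last_cons last_rcons; apply/andP; split.
      rewrite [path _ _ _]/= -/(sorted exch (s :: rcons q s')) cq andbT.
      apply: (exch_common tT sT ft); first by rewrite !inE eqxx orbT.
      by apply: contraNneq et => ->.
    rewrite [path _ _ _]/=; apply/andP; split=> //; rewrite -/exch.
    apply: (exch_common s'T t'T _ f't'); first by rewrite !inE eqxx orbT.
    by apply: contraNneq et' => <-.
  + rewrite (perm_uniq pF) cat_uniq uq uw andbT /=.
    apply/hasPn=> r /wT/andP[_]; apply: contra => rq.
    by have /andP[] := qs _ rq.
  + move=> r; rewrite (perm_mem pF) mem_cat ew npairsD1.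
    apply/orP/idP=> [[/qs/andP[]//|/andP[]//]|rT].
    rewrite rT; have [er|] := boolP (e \in r); last by right.
    left; have : r \in star S e by rewrite starE ?rT.
    rewrite inE mem_rcons inE Fmid // !inE => ->.
    by case: (r == s); case: (r == s').
- have fl a : {in a, forall r : {set E}, e \notin r} ->
      [seq r : {set E} <- a | e \notin r] = a :> seq {set E}.
    by move=> h; apply/all_filterP/allP.
  rewrite Fe filter_cat /= filter_cat /= et et'.
  have -> : [seq r : {set E} <- u | e \notin r] = u.
    by apply: fl => r ru; have /wT/andP[] : r \in u ++ t :: t' :: v by rewrite mem_cat ru.
  have -> : [seq r : {set E} <- v | e \notin r] = v.
    apply: fl => r rv; have /wT/andP[] // : r \in u ++ t :: t' :: v.
    by rewrite mem_cat !inE rv !orbT.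
  rewrite es /=; congr (_ ++ _ :: _); rewrite -[RHS]cat0s; congr (_ ++ _).
  apply/eqP; rewrite -(negbK (_ == _)) -has_filter; apply/hasPn=> r rq.
  by have /andP[_ ->] := qs r (mem_behead (s := s :: _) rq).
- rewrite Fe find_cat; case: hasP => [[r ru er]|_].
    have /andP[_] : (r \in npairs S) && (e \notin r) by apply: wT; rewrite mem_cat ru.
    by rewrite er.
  by rewrite /= (negbTE et) es addn1.
Qed.

(** Since [w] visits all trees avoiding [e], their traces change along [w] at least as often as the
    number of distinct traces less one, and every change leaves room for a detour. *)
Lemma hpath_extend S e x y w : e \in S -> hpath (S :\ e) x y w ->
  many (#|off_class e @: npairs (S :\ e)|.-1 * (#|nonpar S e| - 2)`!)
    (fun w' => hpath S x y w' /\ [seq r : {set E} <- w' | e \notin r] = w).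
Proof.
move=> eS hw; pose lab := off_class e.
pose chg i := nth set0 (map lab w) i != nth set0 (map lab w) i.+1.
have pos : many (#|lab @: npairs (S :\ e)|.-1)
    (fun i => i.+1 < size w /\ lab (nth set0 w i) != lab (nth set0 w i.+1)).
  exists (filter chg (iota 0 (size w).-1)); split.
  - by rewrite filter_uniq ?iota_uniq.
  - have := size_undup_changes set0 (map lab w); rewrite size_map -size_filter -/chg.
    suff -> : #|lab @: npairs (S :\ e)| = size (undup (map lab w)).
      by case: (size _).
    have [_ _ _ _ ew] := hw.
    rewrite -(card_uniqP (undup_uniq _)); apply: eq_card => r; rewrite mem_undup.
    by apply/imsetP/mapP=> -[q qT ->]; exists q; rewrite // ?ew // -ew.
  - move=> i; rewrite mem_filter mem_iota add0n /chg => /andP[h iw].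
    have iw' : i.+1 < size w by move: iw; case: (size w).
    by move: h; rewrite !(nth_map set0) // ltnW.
(* The first tree containing [e] comes right after position [i], so different insertion places give
   different paths. *)
apply: (many_fiber (g := fun w' => (find (fun r : {set E} => e \in r) w').-1)) pos.
move=> i [iw chi].
have wE : w = take i w ++ nth set0 w i :: nth set0 w i.+1 :: drop i.+2 w.
  by rewrite -!drop_nth ?cat_take_drop // ltnW.
have hw' := hw; rewrite wE in hw'.
have [s [us Ns Ps]] := hpath_insert eS hw' chi; exists s; split=> // w' /Ps[hw2 fw fi].
by rewrite fi [X in _ = X]wE fw size_take ltnW.
Qed.

(** An edge [g] parallel to [e] completes each [f] outside the class to a tree that avoids [e] and
    has trace [{f}]. *)
Lemma set1_off_class S e f g : e \in S -> g \in S :\ e -> c g = c e ->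
  f \in nonpar S e -> [set f] \in off_class e @: npairs (S :\ e).
Proof.
move=> eS; rewrite !inE => /andP[ge gS] gc /andP[fS fc].
have fe : f != e by apply: contraNneq fc => ->.
apply/imsetP; exists [set f; g].
  by apply/npairsP; exists f, g; rewrite !inE fe ge fS gS gc.
apply/setP=> x; rewrite !inE; have [->|xf] := eqVneq x f; first by rewrite fc.
by have [->|//] := eqVneq x g; rewrite ?gc ?eqxx ?andbF.
Qed.

(** If [e] has a parallel edge, every non-parallel edge yields a singleton trace; otherwise each
    tree avoiding [e] is its own trace. *)
Lemma leq_card_off_class S e m : e \in S -> m <= #|nonpar S e| ->
  m <= #|npairs (S :\ e)| -> m <= #|off_class e @: npairs (S :\ e)|.
Proof.
move=> eS mN mT; have [/existsP[g /andP[gS /eqP gc]]|noP] :=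
    boolP [exists g, (g \in S :\ e) && (c g == c e)].
  apply: leq_trans mN _; rewrite -(card_imset _ (@set1_inj E)).
  by apply: subset_leq_card; apply/subsetP=> _ /imsetP[f fN ->]; apply: set1_off_class gc fN.
have id r : r \in npairs (S :\ e) -> off_class e r = r.
  rewrite inE => /andP[/subsetP rS _]; apply/setP=> x; rewrite !inE andbC.
  case: (boolP (x \in r)) => //= /rS xS; apply: contraNN noP => xc.
  by apply/existsP; exists x; rewrite xS.
by rewrite card_in_imset // => t t' /id {2}<- /id {2}<-.
Qed.

Definition min_nonpar k S := {in S, forall e, k <= #|nonpar S e|}.

Lemma min_nonparD1 k S e : min_nonpar k S -> min_nonpar k.-1 (S :\ e).
Proof.
move=> kS f; rewrite inE => /andP[_ /kS]; rewrite (cardsD1 e).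
have -> : nonpar S f :\ e = nonpar (S :\ e) f by apply/setP=> x; rewrite !inE andbA.
by case: (e \in _); lia.
Qed.

(** Any edge [f] lies in at least [k] trees. An edge [g] not parallel to [f] has, as [2 <= k], a
    non-parallel edge [x] other than [f], and [{g, x}] is one more tree. *)
Lemma leq_card_npairs k S : 2 <= k -> S != set0 -> min_nonpar k S -> k < #|npairs S|.
Proof.
move=> k2 /set0Pn[f fS] kS.
have /card_gt0P[g gN] : 0 < #|nonpar S f| by apply: leq_trans (kS f fS); lia.
have [gS gf] : g \in S /\ c g != c f by move: gN; rewrite inE => /andP[].
have : 1 < #|nonpar S g| by apply: leq_trans (kS g gS).
rewrite (cardsD1 f) => h; have /card_gt0P[x] : 0 < #|nonpar S g :\ f|.
  by move: h; case: (f \in _); lia.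
rewrite inE in_set1 => /andP[xf xN].
have gxf : [set g; x] \notin star S f.
  rewrite starE // !inE negb_and (eq_sym f x) (negbTE xf) orbF orbC.
  by rewrite (contraNneq _ gf) // => ->.
apply: leq_ltn_trans (kS f fS) _; rewrite -card_star.
apply: leq_trans (_ : #|[set g; x] |: star S f| <= _); first by rewrite cardsU1 gxf.
apply: subset_leq_card; apply/subsetP=> t; rewrite in_setU1 => /predU1P[->|].
  exact: nonpar_npairs.
by rewrite starE // => /andP[].
Qed.

(** The base of the induction: the third tree [{f, g}] exists exactly when [f] and [g] are not
    parallel, and is then visited between the other two. *)
Lemma hpath_triangle e f g : c f != c e -> c g != c e -> f != g ->
  many 1 (hpath [set e; f; g] [set e; f] [set e; g]).
Proof.
move=> fe ge fg.
have ne a b : c a != c b -> a != b by apply: contraNneq => ->.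
have Tef : [set e; f] \in npairs [set e; f; g].
  by apply: nonpar_npairs; rewrite !inE ?fe eqxx ?orbT.
have Teg : [set e; g] \in npairs [set e; f; g].
  by apply: nonpar_npairs; rewrite !inE ?ge eqxx ?orbT.
have efg : [set e; f] != [set e; g] by apply: contra_neq fg => /set2_inj.
have Tfg : ([set f; g] \in npairs [set e; f; g]) = (c f != c g).
  apply/idP/idP=> [/npairs_at/(_ (set21 _ _))[x]|fgc].
    by rewrite inE eq_sym => /andP[_ +] /set2_inj ->.
  by apply: nonpar_npairs; rewrite !inE ?eqxx ?orbT //= eq_sym.
have all t : t \in npairs [set e; f; g] -> [|| t == [set e; f], t == [set e; g] | t == [set f; g]].
  case/npairsP=> a [b [+ + ab ->]]; rewrite !inE -!orbA.
  case/or3P=> /eqP aE; case/or3P=> /eqP bE; subst a b; rewrite ?eqxx ?orbT //;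
  by rewrite ?(setUC [set f] [set e]) ?(setUC [set g]) ?eqxx ?orbT // eqxx in ab *.
have aef : exch [set e; f] [set e; g] by apply: exch_set2 => //; rewrite eq_sym ne.
have [fgc|fgc] := boolP (c f == c g).
  exists [:: [:: [set e; f]; [set e; g]]]; split=> // _ /[!inE] /eqP->.
  split=> //=; first by rewrite aef.
    by rewrite inE efg.
  move=> t; rewrite !in_cons in_nil orbF; apply/orP/idP=> [[]/eqP->//|tT].
  have /or3P[->|->|/eqP tE] := all t tT; [by left | by right | ].
  by move: tT; rewrite tE Tfg fgc.
exists [:: [:: [set e; f]; [set f; g]; [set e; g]]]; split=> // _ /[!inE] /eqP->.
have n1 : [set e; f] != [set f; g].
  by rewrite setUC; apply/eqP=> /set2_inj h; move: ge; rewrite h eqxx.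
have n2 : [set f; g] != [set e; g].
  by rewrite ![[set _; g]]setUC; apply/eqP=> /set2_inj h; move: fe; rewrite h eqxx.
split=> //=.
- rewrite andbT; apply/andP; split.
    by rewrite setUC; apply: exch_set2; rewrite // ?(ne _ _ fe) // eq_sym (ne _ _ ge).
  by rewrite ![[set _; g]]setUC; apply: exch_set2; rewrite ?ne // eq_sym.
- by rewrite !inE negb_or n1 efg n2.
- move=> t; rewrite !in_cons in_nil orbF [(t == [set f; g]) || _]orbC.
  by apply/or3P/idP=> [[]/eqP->|/all/or3P] //; rewrite Tfg.
Qed.

Lemma superfactorialS n : superfactorial n.+1 = superfactorial n * n.+1`!.
Proof. by rewrite /superfactorial big_nat_recr. Qed.

Lemma superfactorial_small k : k <= 2 -> superfactorial k.-1 = 1.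
Proof. by case: k => [|[|[|]]] // _; rewrite /superfactorial unlock. Qed.

Lemma superfactorial_pred k : superfactorial k.-1 <= superfactorial k.-2 * (k.-1)`!.
Proof. by case: k => [|[|k]] /=; rewrite ?superfactorialS ?muln1. Qed.

(** A monotone form of [(k - 1)! = (k - 1) (k - 2)!]; [maxn k 2] keeps the truncated differences
    harmless for [k < 2], values that the induction reaches. *)
Lemma leq_fact_insert k m l : maxn k 2 <= m -> maxn k 2 <= l ->
  (k.-1)`! <= l.-1 * (m - 2)`!.
Proof.
move=> km kl; apply: (@leq_trans ((maxn k 2 - 2).+1)`!); first by apply: leq_fact; lia.
by rewrite factS; apply: leq_mul; [lia | apply: leq_fact; lia].
Qed.

(** Here the star of [e] lacks the two distinct trees that a detour needs. All trees contain [f], so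
    the one new tree [{e, f}] fits between the first two trees of [w]; [x != y] provides the
    second. *)
Lemma hpath_pendant S e f x y w : e \in S -> nonpar S e = [set f] -> x != y ->
  hpath (S :\ e) x y w -> many 1 (hpath S x y).
Proof.
move=> eS Nf xy [hw lw sw uw ew]; case: w hw lw sw uw ew => [|x' [|z w]] /=.
- by move=> xE yE; rewrite -xE -yE eqxx in xy.
- by move=> xE yE; rewrite -xE -yE eqxx in xy.
move=> -> {x'} lw /andP[xz pw] /and3P[xN zN uw] ew.
have Tf r : r \in npairs (S :\ e) -> f \in r.
  case/npairsP=> a [b [+ + ab ->]]; rewrite !in_setD1 => /andP[_ aS] /andP[_ bS].
  have [ae|ae] := eqVneq (c a) (c e).
    have : b \in nonpar S e by rewrite inE bS -ae eq_sym.
    by rewrite Nf => /set1P->; rewrite set22.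
  have : a \in nonpar S e by rewrite inE aS.
  by rewrite Nf => /set1P->; rewrite set21.
have sT : [set e; f] \in npairs S by apply: nonpar_npairs; rewrite // Nf set11.
have Ts r : r \in x :: z :: w -> [/\ r \in npairs S, f \in r & r != [set e; f]].
  rewrite ew => /[dup] /Tf fr; rewrite npairsD1 => /andP[rT er]; split=> //.
  by apply: contraNneq er => ->; rewrite set21.
have [xT fx xs] := Ts x (mem_head _ _).
have [|zT fz zs] := Ts z; first by rewrite !inE eqxx orbT.
exists [:: [:: x, [set e; f], z & w]]; split=> // _ /[!inE] /eqP->; split=> //=.
- by rewrite pw andbT (exch_common xT sT fx) ?(exch_common sT zT _ fz) ?set22 // eq_sym.
- rewrite uw zN !andbT inE negb_or xs xN /=.
  by apply/negP=> sw; have [] := Ts [set e; f]; rewrite ?eqxx // inE sw orbT.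
- move=> r; rewrite !in_cons; have [->|rs] := eqVneq r [set e; f].
    by rewrite orbT sT.
  have -> : [|| r == x, false, r == z | r \in w] = (r \in x :: z :: w) by rewrite !in_cons.
  rewrite ew npairsD1; apply: andb_idr => rT; apply: contra rs => er.
  by have [g] := npairs_at rT er; rewrite Nf => /set1P -> ->.
Qed.

(** Induction on [#|S|], for all [k] at once because a deletion may lower the bound by one. The
    deleted edge [e] lies outside [t] and [t'], so both survive. *)
Lemma many_hpath k S t t' : min_nonpar k S ->
  t \in npairs S -> t' \in npairs S -> exch t t' ->
  many (superfactorial k.-1) (hpath S t t').
Proof.
have [n] := ubnP #|S|; elim: n => // n IHn in k S t t' *; rewrite ltnS => Sn kS tT t'T tt'.
have [e0 [f [g [fN gN fg te te']]]] := exchP tT t'T tt'.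
have tnt : t != t' by rewrite te te'; apply: contra_neq fg => /set2_inj.
have [[fS fe] [gS ge]] : (f \in S /\ c f != c e0) /\ (g \in S /\ c g != c e0).
  by move: fN gN; rewrite !inE => /andP[? ?] /andP[].
have e0S : e0 \in S by move: tT; rewrite te inE => /andP[/subsetP->] //; rewrite set21.
have sS : [set e0; f; g] \subset S.
  by apply/subsetP=> x; rewrite !inE -orbA => /or3P[]/eqP->.
have [SE|/subsetPn[e eS]] := boolP (S \subset [set e0; f; g]).
  have {}SE : S = [set e0; f; g] by apply/eqP; rewrite eqEsubset SE.
  apply: (@many_leq _ _ 1); last by rewrite te te' SE; apply: hpath_triangle.
  suff k2 : k <= 2 by rewrite superfactorial_small.
  (* The numeral [2] is folded back into [#|[set f; g]|], since only [f] and [g] can be non-parallel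
     to [e0]. *)
  apply: leq_trans (kS e0 e0S) _; rewrite -[2]/(true.+1) -fg -cards2.
  apply: subset_leq_card; apply/subsetP=> x.
  by rewrite SE !inE -orbA; case: eqVneq => [->|]; rewrite ?eqxx ?andbF //= => _ /andP[].
rewrite !inE -orbA !negb_or => /and3P[ee0 ef eg].
have cardSe : #|S :\ e| < n by move: Sn; rewrite (cardsD1 e) eS.
have tT' : t \in npairs (S :\ e) by rewrite npairsD1 tT te !inE negb_or ee0.
have t'T' : t' \in npairs (S :\ e) by rewrite npairsD1 t'T te' !inE negb_or ee0.
have IH j : min_nonpar j (S :\ e) -> many (superfactorial j.-1) (hpath (S :\ e) t t').
  by move=> jS; apply: IHn.
have m0 : 0 < #|nonpar S e|.
  have [e0e|e0e] := eqVneq (c e0) (c e).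
    by apply/card_gt0P; exists f; rewrite inE fS -e0e.
  by apply/card_gt0P; exists e0; rewrite inE e0S.
have [m1|m1] := eqVneq #|nonpar S e| 1.
  have /eqP/cards1P[x xE] := m1.
  (* Here [k <= 1], so one path is enough; the induction hypothesis at [0], where [min_nonpar] is
     trivial, provides it. *)
  have [[|w s] [_ // _ Ps]] : many 1 (hpath (S :\ e) t t').
    by rewrite -(@superfactorial_small 0) //; apply: IH => ? _.
  have hw := Ps w (mem_head _ _).
  rewrite superfactorial_small; last by apply: leq_trans (kS e eS) _; rewrite m1.
  exact: hpath_pendant eS xE tnt hw.
have mK : maxn k 2 <= #|nonpar S e| by rewrite geq_max kS // ltn_neqAle eq_sym m1.
(* For [k <= 2] the trees [t] and [t'] suffice; beyond, the strict bound of [leq_card_npairs] at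
   [k - 1] makes up for the deletion. *)
have TK : maxn k 2 <= #|npairs (S :\ e)|.
  have T2 : 2 <= #|npairs (S :\ e)|.
    rewrite -[2]/(true.+1) -tnt -cards2; apply: subset_leq_card.
    by apply/subsetP=> x /set2P[]->.
  rewrite geq_max T2 andbT; have [k2|k2] := leqP k 2; first exact: leq_trans k2 T2.
  have k1 : k.-1.+1 = k by rewrite prednK // ltnW // ltnW.
  rewrite -k1; apply: leq_card_npairs (min_nonparD1 kS); first by rewrite -ltnS k1.
  by apply/set0Pn; exists e0; rewrite !inE e0S eq_sym ee0.
have LK := leq_card_off_class eS mK TK.
apply: many_leq (superfactorial_pred k) _.
apply: (@many_leq _ _ (superfactorial k.-2 *
   (#|off_class e @: npairs (S :\ e)|.-1 * (#|nonpar S e| - 2)`!))).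
  by rewrite leq_mul2l leq_fact_insert ?orbT.
(* Dropping the trees through [e] recovers the smaller path, so distinct paths have distinct
   extensions. *)
apply: (many_fiber (g := fun w' => [seq r : {set E} <- w' | e \notin r]))
  (IH k.-1 (min_nonparD1 kS)).
by move=> w hw; apply: hpath_extend.
Qed.

End RankTwo.

(** * Paths as lists of two-element sets *)

Section Steps.
Variable T : finType.
Implicit Types (x y : T) (p q : seq T).

Definition steps x p : seq {set T} := pairmap (fun y z => [set y; z]) x p.

Lemma mem_steps x p A y : A \in steps x p -> y \in A -> y \in x :: p.
Proof.
elim: p x => //= z p IHp x; rewrite inE => /predU1P[->|/IHp h].
  by rewrite !inE orbA => ->.
by move=> /h yp; rewrite in_cons yp orbT.
Qed.

Lemma steps_rcons x p y : steps x (rcons p y) = rcons (steps x p) [set last x p; y].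
Proof. by rewrite -cats1 /steps pairmap_cat cats1. Qed.

(** Only the first step contains the start [x], so the set of steps determines the second vertex;
    the rest follows by induction. *)
Lemma steps_inj x p q : uniq (x :: p) -> uniq (x :: q) ->
  steps x p =i steps x q -> p = q.
Proof.
elim: p x q => [|y p IHp] x [|z q] // up uq epq.
- by have := epq [set x; z]; rewrite !inE eqxx.
- by have := epq [set x; y]; rewrite !inE eqxx.
have xNp A : A \in steps y p -> A != [set x; y].
  move=> Ap; apply: contraTneq up => AE.
  by rewrite /= (mem_steps Ap) // AE set21.
have xNq A : A \in steps z q -> x \notin A.
  by move=> Aq; apply: contraTN uq => xA; rewrite /= (mem_steps Aq).
have yz : y = z.
  have := epq [set x; y]; rewrite /= !inE eqxx /= => /esym/predU1P[/set2_inj//|/xNq].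
  by rewrite set21.
subst z; congr (_ :: _); apply: (IHp y).
- by case/andP: up.
- by case/andP: uq.
move=> A; have := epq A; rewrite /= !in_cons -/(steps y p) -/(steps y q).
have [->|//] := eqVneq A [set x; y].
have -> : [set x; y] \in steps y p = false by apply/negbTE/negP=> /xNp; rewrite eqxx.
by have -> : [set x; y] \in steps y q = false by apply/negbTE/negP=> /xNq; rewrite set21.
Qed.

(** The only step containing [x] leads to the second vertex, which is not the last one when there
    are at least three. *)
Lemma closing_step_notin x p : uniq (x :: p) -> 1 < size p ->
  [set last x p; x] \notin steps x p.
Proof.
case: p => [|y [|z p]] // up _; rewrite /= inE negb_or; apply/andP; split.
  rewrite setUC; apply/eqP=> /set2_inj ly.
  by case/and3P: up => _ + _; rewrite -ly mem_last.
by apply: contraTN up => /(@mem_steps y (z :: p)) h; rewrite [uniq _]/= h // set22.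
Qed.

End Steps.

(** * From Hamiltonian paths to Hamiltonian cycles of the basis graph *)

Section HamiltonianCycles.
Variables (E : finType) (M : matroid E).
Local Notation bG := (basis_graph M).
Implicit Types (x y : basis M) (p q : seq (basis M)).

Definition cycle_edges x p : {set edge bG} :=
  [set e | val e \in steps x (rcons p x)].

Definition basis_path x y p :=
  [/\ path (@exchange_adjacent E M) x p, last x p = y, uniq (x :: p)
    & forall z, z \in x :: p].

Lemma basis_edge_step x p A : path (@exchange_adjacent E M) x p ->
  A \in steps x p -> exists e : edge bG, val e = A.
Proof.
elim: p x => //= y p IHp x /andP[xy /IHp{}IHp]; rewrite inE => /predU1P[->|/IHp//].
have eP : [exists B, exists B', ([set x; y] == [set B; B']) && exchange_adjacent B B'].
  by apply/existsP; exists x; apply/existsP; exists y; rewrite eqxx.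
by exists (Sub [set x; y] eP).
Qed.

Lemma hamiltonian_cycle_edges x p : path (@exchange_adjacent E M) x (rcons p x) ->
  uniq (x :: p) -> 1 < size p -> (forall y, y \in x :: p) ->
  is_hamiltonian_cycle (cycle_edges x p).
Proof.
move=> pp up p1 allp; exists (x :: p); split=> //.
(* Consecutive bases are adjacent, so [insub] discards no step. *)
pose es : seq (edge bG) := pmap insub (steps x (rcons p x)).
have esE : map val es = steps x (rcons p x).
  rewrite /es (pmap_filter (insubK _)); apply/all_filterP/allP=> A /(basis_edge_step pp)[e <-].
  by rewrite valK.
exists es; split=> //.
- apply: (@map_uniq _ _ val); rewrite esE steps_rcons rcons_uniq closing_step_notin //.
  exact: (@uniq_pairs bG).
- by rewrite (@cycle_pairs bG).
- by move=> e; rewrite inE -esE (mem_map val_inj).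
Qed.

(** Adding [eps] closes a Hamiltonian path from [x] to [y]. As [eps] is not a step of the path,
    removing it from the cycle gives back the steps, hence the path. *)
Lemma leq_HC_edge N x y (eps : edge bG) : val eps = [set x; y] ->
  exchange_adjacent x y -> 2 < #|basis M| -> many N (basis_path x y) -> N <= HC_edge eps.
Proof.
move=> epsE xy M3; have p1 p : basis_path x y p -> 1 < size p.
  case=> _ _ _ allp; suff : 2 < size (x :: p) by []; apply: leq_trans M3 _.
  by rewrite cardT; apply: uniq_leq_size (enum_uniq _) _ => z _; apply: allp.
have closed p : basis_path x y p -> path (@exchange_adjacent E M) x (rcons p x).
  by case=> pp ly _ _; rewrite rcons_path pp ly /= /exchange_adjacent setUC.
apply: (@leq_card_many _ _ _ _ (cycle_edges x)) => [p q Pp Pq pq|p Pp]; last first.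
  have [pp ly up allp] := Pp; rewrite inE; apply/andP; split.
    by apply/asboolP/hamiltonian_cycle_edges; rewrite ?p1 ?closed.
  by rewrite inE epsE steps_rcons mem_rcons ly setUC mem_head.
have [_ lp up _] := Pp; have [_ lq uq _] := Pq.
have sub r s : basis_path x y r -> basis_path x y s -> cycle_edges x r = cycle_edges x s ->
    {subset steps x r <= steps x s}.
  move=> Pr Ps rs A Ar; have [pr lr ur _] := Pr; have [_ ls us _] := Ps.
  have [e eA] := basis_edge_step pr Ar.
  have : e \in cycle_edges x s by rewrite -rs inE eA steps_rcons mem_rcons inE Ar orbT.
  rewrite inE eA steps_rcons mem_rcons inE => /predU1P[AE|//].
  by have := closing_step_notin ur (p1 _ Pr); rewrite lr -ls -AE Ar.
by apply: (steps_inj up uq) => A; apply/idP/idP; apply: sub.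
Qed.

(** Every entry of a Hamiltonian path is a basis, so lifting to [basis M] loses nothing; the head is
    split off because [basis_path] takes it as [x]. *)
Lemma many_basis_path (K : eqType) (c : E -> K) N x y :
  bases M = npairs c setT -> many N (hpath c setT (val x) (val y)) ->
  many N (basis_path x y).
Proof.
move=> MN; pose lift w : seq (basis M) := pmap insub w.
apply: (many_map (f := fun w => behead (lift w)) (g := fun p => val x :: map val p)) => w.
case=> hw lw sw uw ew.
have liftK : map val (lift w) = w.
  rewrite /lift (pmap_filter (insubK _)); apply/all_filterP/allP=> t.
  by rewrite ew -MN => tM; rewrite insubT.
case: (lift w) liftK => [|z p] /= wE; last first.
  have zx : z = x by apply: val_inj; rewrite -hw -wE.
  subst z; split=> //; split.
  - by move: sw; rewrite -wE /= path_map.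
  - by apply: val_inj; rewrite -lw -wE /= last_map.
  - by rewrite -(map_inj_uniq val_inj) map_cons wE.
  - move=> B; rewrite -(mem_map val_inj) /= wE ew -MN; exact: valP.
by have := ew (val x); rewrite -wE -MN (valP x).
Qed.

End HamiltonianCycles.

(** * Spanning trees of graphs of order three *)

Section OrderThree.
Variable G : mgraph.
Implicit Types (T F : {set edge G}) (x y z : vertex G) (e f : edge G).

Lemma connect_incident F x y : connect (adjacent F) x y -> x != y ->
  exists2 f, f \in F & x \in ends f.
Proof.
case/connectP=> -[|z p] /= => [_ ->|]; first by rewrite eqxx.
by case/andP=> /adjacentP[f fF fE] _ _ _; exists f; rewrite // fE set21.
Qed.

Hypothesis G3 : Defs.order G = 3.

Lemma third_vertex x y : exists2 z, z != x & z != y.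
Proof.
have : 0 < #|~: [set x; y]|.
  by rewrite cardsCs setCK (G3 : #|vertex G| = 3) cards2; case: eqP.
by case/card_gt0P=> z; rewrite !inE negb_or => /andP[zx zy]; exists z.
Qed.

Lemma vertex3 x y z u : x != y -> z != x -> z != y -> [|| u == x, u == y | u == z].
Proof.
move=> xy zx zy; have := in_setT u.
suff <- : [set x; y; z] = setT by rewrite !inE orbA.
apply/eqP; rewrite eqEcard subsetT cardsT (G3 : #|vertex G| = 3) setUC cardsU1 cards2 xy.
by rewrite !inE negb_or zx zy.
Qed.

Lemma ends_eq e x y : x \in ends e -> y \in ends e -> x != y -> ends e = [set x; y].
Proof.
move=> xe ye xy; apply/esym/eqP; rewrite eqEcard card_ends cards2 xy andbT.
by apply/subsetP=> z /set2P[]->.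
Qed.

(** If [e] joins [x] and [y], then [f] reaches the third vertex, and its other end is [x] or [y]. *)
Lemma connected_by_pair e f : ends e != ends f -> connected_by [set e; f].
Proof.
move=> ef; have [x [y eE]] := endsP e.
have xy : x != y by have := card_ends e; rewrite eE cards2; case: eqP.
have [z zx zy] := third_vertex x y.
have zf : z \in ends f.
  have : ~~ (ends f \subset ends e).
    by apply: contraNN ef => fe; rewrite eq_sym eqEcard fe !card_ends.
  case/subsetPn=> u uf; rewrite eE !inE => /norP[ux uy].
  by have := vertex3 u xy zx zy; rewrite (negbTE ux) (negbTE uy) => /eqP <-.
have cxy : connect (adjacent [set e; f]) x y by apply: connect_ends eE; rewrite set21.
have cxz : connect (adjacent [set e; f]) x z.
  have [a [b fE]] := endsP f.
  have [u uf uz] : exists2 u, u \in ends f & u != z.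
    have : z \in [set a; b] by rewrite -fE.
    have ab : a != b by have := card_ends f; rewrite fE cards2; case: eqP.
    by case/set2P=> ->; [exists b | exists a]; rewrite ?fE ?set21 ?set22 // eq_sym.
  have uzc : connect (adjacent [set e; f]) u z.
    by apply: (@connect_ends _ _ f); rewrite ?set22 //; apply: ends_eq.
  have := vertex3 u xy zx zy; rewrite (negbTE uz) orbF => /orP[]/eqP uE; subst u => //.
  exact: connect_trans uzc.
have cx u : connect (adjacent [set e; f]) x u.
  by have /or3P[/eqP->|/eqP->|/eqP->] := vertex3 u xy zx zy; rewrite ?connect0.
apply/connected_byP=> u v; apply: connect_trans (cx v).
by rewrite connect_adjacent_sym.
Qed.

(** The ends of an edge [g] of a cycle stay connected without [g]; with a single edge left, that
    edge would be parallel to [g]. *)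
Lemma acyclic_pair e f : ends e != ends f -> acyclic [set e; f].
Proof.
move=> ef C sC cC.
have [g gC] : exists g, g \in C.
  case: (cC) => -[|x p] [[|g es] [// _ _ _ //= _ CE]].
  by exists g; rewrite CE mem_head.
have [x [y gE]] := endsP g.
have xy : x != y by have := card_ends g; rewrite gE cards2; case: eqP.
have cxy := cycle_connect cC gC gE.
have [h hC xh] := connect_incident cxy xy.
have [h' h'C yh] : exists2 h', h' \in C :\ g & y \in ends h'.
  by apply: (@connect_incident _ y x); rewrite 1?connect_adjacent_sym // eq_sym.
(* Besides [g], the set [C] has at most one edge, which therefore meets both [x] and [y]. *)
have ends_h : ends h != ends g /\ h = h'.
  move: gC hC h'C; rewrite !inE => /(subsetP sC) + /andP[hg /(subsetP sC) +].
  move=> + + /andP[h'g /(subsetP sC) +]; move: hg h'g.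
  rewrite !inE => + + /orP[]/eqP gE' /orP[]/eqP hE /orP[]/eqP hE';
    subst g h h'; rewrite ?eqxx // => _ _.
  by rewrite eq_sym.
case: ends_h => hg hh'; case/negP: hg; rewrite gE; apply/eqP.
by apply: ends_eq; rewrite // hh'.
Qed.

(** A connected [T] has an edge [a] and an edge [b] at the vertex missed by [a]. These two already
    connect the graph, so any further edge of [T] would close a cycle. *)
Lemma spanning_treesE : spanning_trees G = npairs (@ends G) setT.
Proof.
apply/setP=> T; apply/spanning_treesP/npairsP=> [[cT aT]|[a [b [_ _ ab ->]]]]; last first.
  by split; [apply: connected_by_pair | apply: acyclic_pair].
have /connected_byP cT' := cT.
have [x [y xy]] : exists x y : vertex G, x != y.
  have : 0 < #|vertex G| by rewrite (G3 : #|vertex G| = 3).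
  by case/card_gt0P=> x _; have [y yx _] := third_vertex x x; exists y, x.
have [a aT' _] := connect_incident (cT' x y) xy.
have [u [v aE]] := endsP a.
have [z zu zv] := third_vertex u v.
have [b bT zb] := connect_incident (cT' z u) zu.
have ab : ends a != ends b.
  by apply/eqP=> h; move: zb; rewrite -h aE !inE (negbTE zu) (negbTE zv).
exists a, b; split=> //; apply/eqP; rewrite eqEsubset andbC; apply/andP; split.
  by apply/subsetP=> f /set2P[]->.
apply/subsetP=> f fT; apply/negPn/negP=> fab.
have [p [q fE]] := endsP f; have /connected_byP/(_ p q) cpq := connected_by_pair ab.
have [C cC sC] := Defs.connect_cycle fab fE cpq.
apply: (aT C) cC; apply: subset_trans sC _; apply/subsetP=> g.
by rewrite !inE => /or3P[]/eqP->.
Qed.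

(** Deleting all edges not parallel to [e] isolates the third vertex, so there are at least [k] of
    them. *)
Lemma min_nonpar_edge_connected k :
  edge_connected k G -> min_nonpar (@ends G) k setT.
Proof.
case=> _ kG e _; rewrite leqNgt; apply/negP=> /kG/connected_byP c.
have [x [y eE]] := endsP e; have [z zx zy] := third_vertex x y.
have [f] := connect_incident (c z x) zx; rewrite !inE negbK => /eqP ->.
by rewrite eE !inE (negbTE zx) (negbTE zy).
Qed.

End OrderThree.

(** Nonemptiness matters because [min_nat] is [0] on an empty predicate. *)
Lemma leq_min_nat N (P : nat -> Prop) :
  (exists m, P m) -> (forall m, P m -> N <= m) -> N <= min_nat P.
Proof.
move=> [m Pm] NP; rewrite /min_nat; case: pselect => [exP|[]].
  by case: ex_minnP => n /asboolP/NP.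
by exists m; apply/asboolP.
Qed.

(** * A [k]-edge-connected graph of order three *)

Section Thick.
Variable k : nat.

Lemma card_setC1_I3 (e : 'I_3 * 'I_k) : #|[set~ e.1]| = 2.
Proof. by rewrite cardsC1 card_ord. Qed.

(** The edge [(z, j)] is the [j]-th of [k] parallel edges opposite the vertex [z]. *)
Definition thick_triangle : mgraph := MGraph card_setC1_I3.

(** Fewer than [k] deletions leave one of the [k] edges between any two vertices. *)
Lemma thick_triangle_edge_connected : edge_connected k thick_triangle.
Proof.
split=> [|F Fk]; first by rewrite /Defs.order card_ord.
apply/connected_byP=> x y; have [->|xy] := eqVneq x y; first exact: connect0.
have /cards1P[z zE] : #|~: [set x; y]| == 1 by rewrite cardsCs setCK cards2 xy card_ord.
have [j jF] : exists j, (z, j) \notin F.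
  apply/existsP; rewrite -negb_forall; apply: contraTN Fk => /forallP allF.
  rewrite -leqNgt -[k]card_ord -cardsT -(card_imset _ (f := fun j => (z, j))).
    by apply: subset_leq_card; apply/subsetP=> _ /imsetP[j _ ->].
  by move=> j j' [].
apply: (@connect_ends thick_triangle _ (z, j)); first by rewrite inE.
by rewrite /= -zE setCK.
Qed.

End Thick.

(** * The bound for each graph and for the minimum *)

Lemma edge_connectedP k G : 0 < k -> edge_connected k G -> connected G.
Proof. by move=> k0 [_ /(_ set0)]; rewrite cards0 setC0; apply. Qed.

Lemma leq_HC_star k G (cG : connected G) : 3 <= k -> Defs.order G = 3 ->
  edge_connected k G -> superfactorial (k - 1) <= HC_star (cycle_matroid cG).
Proof.
move=> k3 G3 kG; set M := cycle_matroid cG.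
have MN : bases M = npairs (@ends G) setT := spanning_treesE G3.
have kN := min_nonpar_edge_connected G3 kG.
(* With only two bases, closing a path would repeat its edge. *)
have M3 : 3 < #|bases M|.
  apply: (leq_ltn_trans k3); rewrite MN; apply: leq_card_npairs (ltnW k3) _ kN.
  have /set0Pn[t] := bases_neq0 M; rewrite MN => /npairsP[a [_ [_ _ _ _]]].
  by apply/set0Pn; exists a; apply: in_setT.
apply: leq_min_nat => [|_ [eps ->]].
  (* The basis graph has an edge: two edges [f] and [g] not parallel to [a] give adjacent trees
     [{a, f}] and [{a, g}]. *)
  have /set0Pn[t tM] := bases_neq0 M; have := tM; rewrite MN => /npairsP[a [b [_ _ ab _]]].
  have /card_gt1P[f [g [fN gN fg]]] : 1 < #|nonpar (@ends G) setT a|.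
    by apply: leq_trans (kN a _); rewrite // ltnW.
  have T h : h \in nonpar (@ends G) setT a -> [set a; h] \in bases M.
    by rewrite MN; apply: nonpar_npairs.
  pose B : basis M := Sub [set a; f] (T f fN); pose B' : basis M := Sub [set a; g] (T g gN).
  have BB' : exchange_adjacent B B'.
    rewrite /exchange_adjacent !SubK; apply: (@exch_set2 (edge G)); rewrite // eq_sym.
      by move: (fN); rewrite inE; apply: contraTneq => ->; rewrite eqxx andbF.
    by move: (gN); rewrite inE; apply: contraTneq => ->; rewrite eqxx andbF.
  have [|e _] := @basis_edge_step _ M B [:: B'] [set B; B'] _ (mem_head _ _).
    by rewrite /= BB'.
  by exists (HC_edge e), e.
have /existsP[B /existsP[B' /andP[/eqP epsE BB']]] := valP eps.
apply: (leq_HC_edge epsE BB'); first by rewrite card_sig; apply: ltnW.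
apply: (many_basis_path MN); rewrite subn1; apply: (many_hpath kN) BB'.
  by rewrite -MN (valP B).
by rewrite -MN (valP B').
Qed.

Theorem theorem2p17 (k : nat) (hk : 3 <= k) : superfactorial (k - 1) <= hc 3 k.
Proof.
(* The thick triangle shows that the minimum is over a nonempty family. *)
apply: leq_min_nat => [|_ [G [cG [G3 kG ->]]]]; last exact: leq_HC_star.
have kG := thick_triangle_edge_connected k.
have cG := edge_connectedP (ltnW (ltnW hk)) kG.
exists (HC_star (cycle_matroid cG)), (thick_triangle k), cG.
by split; rewrite // /Defs.order card_ord.
Qed.
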